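(* Fix an arbitrary constant $\epsilon>0$. Let $r=r(n)$ be a positive integer with $r=O\left(\frac{n^{1/3}}{\log^{4/3+\epsilon} n}\right)$. Then the number of metric spaces on the point set $[n]$ all of whose distances lie in $\{1,\ldots,r\}$ is $$\left\lceil\frac{r+1}{2}\right\rceil^{\binom{n}{2}+o(n^2)}.$$
   Context: A metric space on $[n]$ with distances in $\{1,\dots,r\}$ means a function $d:\binom{[n]}{2}\to\{1,\dots,r\}$ such that $d(\{x,y\})\le d(\{x,z\})+d(\{z,y\})$ for all distinct $x,y,z\in[n]$; the points are labelled, so distinct functions are counted as distinct metric spaces. The $o(n^2)$ term is as $n\to\infty$. *)

(* Defs.v *)
From mathcomp Require Import all_boot.
Set Implicit Arguments.
Unset Strict Implicit.
Unset Printing Implicit Defensive.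

Notation point_pair n := {e : {set 'I_n} | #|e| == 2}.

(* [dist d x y] is d({x,y}) when x != y.  For x = y the set [set x; y] has one
   element and the value is the dummy 0. *)
Definition dist (n r : nat) (d : {ffun point_pair n -> 'I_r.+1})
    (x y : 'I_n) : nat :=
  if insub [set x; y] is Some e then d e else 0.

(* 'I_r.+1 is {0, ..., r}; the first conjunct restricts the values to
   {1, ..., r}. *)
Definition is_metric (n r : nat) (d : {ffun point_pair n -> 'I_r.+1}) : bool :=
  [forall e, 0 < d e] &&
  [forall x, forall y, forall z,
     [&& x != y, x != z & z != y] ==> (dist d x y <= dist d x z + dist d z y)].

Definition num_metrics (n r : nat) : nat :=
  #|[pred d : {ffun point_pair n -> 'I_r.+1} | is_metric d]|.

(* Main.v *)
Require Import Defs.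
From mathcomp Require Import all_boot all_order all_algebra.
From mathcomp Require Import all_classical all_reals all_analysis.
From mathcomp Require Import zify ring lra.
Set Implicit Arguments.
Unset Strict Implicit.
Unset Printing Implicit Defensive.
Import Order.TTheory GRing.Theory Num.Theory.
Import numFieldNormedType.Exports.

(** Put [m = floor(r/2) + 1 = ceil((r+1)/2)].  Metrics with all distances in
    [{r - m + 1, ..., r}] give the lower bound.  For the upper bound, a metric [d]
    is described, up to few exceptional pairs, by its distances to a bounded number
    of sampled points [s].  Write [b x y] for the minimum of [d x s + d s y] over the
    first sample.  Among [t + 1] random points at most one beats all the others, so
    [b x y <= d x z + d z y] for all but a fraction [1 / (t + 1)] of the triples.
    Two further samples turn this into lower bounds [L <= d], determined by the
    sampled distances, with [b x y <= L x z + L y z] for most triples.  The interval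
    lengths [s = b - L + 1] then satisfy [s x y + s x z + s y z <= 3 m + 1] on most
    triples, which by averaging over cliques of bounded size forces the mean of [s]
    to be at most [(1 + o(1)) m], and the inequality of arithmetic and geometric
    means bounds the number of metrics having a given description. *)

(** * Averages over random tuples, and the sampling lemma *)

Lemma exists_le_average (T : finType) (F : T -> nat) (c : nat) :
  0 < #|T| -> \sum_x F x <= #|T| * c -> exists x, F x <= c.
Proof.
move=> /card_gt0P[x0 _] le_sum; apply/existsP; apply: contraLR le_sum.
rewrite negb_exists -ltnNge => /forallP lt_c.
rewrite -sum_nat_const; rewrite (bigD1 x0) //= [ltnRHS](bigD1 x0) //=.
rewrite -addSn leq_add ?ltnNge ?lt_c //.
by apply: leq_sum => x _; rewrite ltnW // ltnNge lt_c.
Qed.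

Section Resampling.
Variables I V : finType.
Implicit Types (f : {ffun I -> V}) (i j l : I).

Definition update f i (x : V) : {ffun I -> V} :=
  [ffun j => if j == i then x else f j].

Lemma sum_update i (G : {ffun I -> V} -> nat) :
  \sum_(f : {ffun I -> V}) \sum_x G (update f i x) =
  #|V| * \sum_(f : {ffun I -> V}) G f.
Proof.
have swapK : involutive (fun p : {ffun I -> V} * V => (update p.1 i p.2, p.1 i)).
  case=> f x /=; congr pair; last by rewrite ffunE eqxx.
  by apply/ffunP => j; rewrite !ffunE; case: eqP => [->|].
rewrite big_distrr /= [RHS](eq_bigr (fun f => \sum_(x : V) G f)); last first.
  by move=> f _; rewrite sum_nat_const.
by rewrite !pair_bigA /= [RHS](reindex_inj (inv_inj swapK)).
Qed.

(** This and the next two lemmas express, with denominators cleared, that distinct coordinates of a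
    uniform [f] are independent and uniform. *)
Lemma sum_marginal1 i (g : V -> nat) :
  #|V| * \sum_(f : {ffun I -> V}) g (f i) = #|V| ^ #|I| * \sum_x g x.
Proof.
rewrite -(sum_update i (fun f => g (f i))) -card_ffun -sum_nat_const.
by apply: eq_bigr => f _; apply: eq_bigr => x _; rewrite ffunE eqxx.
Qed.

Lemma sum_marginal2 i j (g : V -> V -> nat) : i != j ->
  #|V| ^ 2 * \sum_(f : {ffun I -> V}) g (f i) (f j) = #|V| ^ #|I| * \sum_x \sum_y g x y.
Proof.
move=> ij; rewrite expnS expn1 -mulnA -(sum_update i (fun f => g (f i) (f j))).
rewrite exchange_big !big_distrr; apply: eq_bigr => x _ /=.
rewrite -(sum_marginal1 j (g x)); congr (_ * _); apply: eq_bigr => f _.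
by rewrite !ffunE eqxx eq_sym (negPf ij).
Qed.

Lemma sum_marginal3 i j l (g : V -> V -> V -> nat) :
  i != j -> i != l -> j != l ->
  #|V| ^ 3 * \sum_(f : {ffun I -> V}) g (f i) (f j) (f l) =
  #|V| ^ #|I| * \sum_x \sum_y \sum_z g x y z.
Proof.
move=> ij il jl.
rewrite expnSr -mulnA -(sum_update i (fun f => g (f i) (f j) (f l))).
rewrite exchange_big !big_distrr; apply: eq_bigr => x _ /=.
rewrite -(sum_marginal2 (g x) jl); congr (_ * _); apply: eq_bigr => f _.
by rewrite !ffunE eqxx [j == i]eq_sym [l == i]eq_sym (negPf ij) (negPf il).
Qed.

End Resampling.

(* Among t + 1 exchangeable values at most one is a strict maximum. *)
Lemma strict_max_last (V : finType) (t : nat) (phi : V -> nat) :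
  t.+1 * (\sum_(S : {ffun 'I_t -> V}) \sum_x (\max_i phi (S i) < phi x))
  <= #|V| ^ t.+1.
Proof.
pose top (g : {ffun 'I_t.+1 -> V}) i :=
  [forall j, (j != i) ==> (phi (g j) < phi (g i))].
have le_top i : \sum_(S : {ffun 'I_t -> V}) \sum_x (\max_i phi (S i) < phi x)
    <= \sum_(g : {ffun _ -> V}) top g i.
  (* Inserting [x] at position [i] is a bijection onto [t.+1]-tuples and turns a strict maximum into
     [top _ i]. This works for every [i], while a tuple has at most one top index. *)
  pose h (p : {ffun 'I_t -> V} * V) : {ffun 'I_t.+1 -> V} :=
    [ffun j => if unlift i j is Some j' then p.1 j' else p.2].
  pose h' (g : {ffun 'I_t.+1 -> V}) := ([ffun j => g (lift i j)], g i).
  have hK : cancel h h'.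
    case=> S x; rewrite /h /h' ffunE unlift_none; congr pair.
    by apply/ffunP => j; rewrite !ffunE liftK.
  have h'K : cancel h' h.
    by move=> g; apply/ffunP => j; rewrite ffunE; case: unliftP => [k|] ->;
      rewrite /= ?ffunE.
  rewrite [leqRHS](reindex h) /=; last by apply: onW_bij; exists h'.
  rewrite pair_bigA; apply: leq_sum => -[S x] _ /=.
  case: ltnP => // lt_max; rewrite lt0b; apply/forallP => j; apply/implyP => ji.
  rewrite !ffunE unlift_none; case: unliftP ji => [k ->|->]; last by rewrite eqxx.
  move=> _ /=; apply: leq_ltn_trans lt_max; exact: leq_bigmax.
rewrite -{1}(card_ord t.+1) -sum_nat_const.
apply: leq_trans (leq_sum _ (fun i _ => le_top i)) _.
rewrite exchange_big -[leqRHS]muln1 -[in leqRHS](card_ord t.+1) -card_ffun.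
rewrite -sum_nat_const; apply: leq_sum => g _.
case: (pickP (top g)) => [i top_i|no_top]; last first.
  by rewrite big1 // => i _; rewrite no_top.
rewrite (bigD1 i) //= big1 ?addn0 ?leq_b1 // => j ji.
apply/eqP; rewrite eqb0; apply: contraNN ji => /forallP/(_ i)/implyP top_j.
apply: contraT => ji; move/forallP/(_ j)/implyP/(_ ji): top_i => lt1.
by have := top_j; rewrite eq_sym ji => /(_ isT); rewrite ltnNge (ltnW lt1).
Qed.

Lemma ltn_bigmax_sum (I : finType) (F : I -> nat) c :
  (c < \max_i F i) <= \sum_i (c < F i).
Proof.
case: (pickP (fun i => c < F i)) => [i lt_cF|le_Fc].
  by rewrite [leqRHS](bigD1 i) //= lt_cF (leq_trans (leq_b1 _)).
rewrite ltnNge; suff -> : \max_i F i <= c by [].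
by apply/bigmax_leqP => i _; rewrite leqNgt le_Fc.
Qed.

Section Sampling.
Variable V : finType.
Hypothesis V_gt0 : 0 < #|V|.

(** Average over a uniform [S]: a union bound over the [t] sample points controls the first sum, and
    [strict_max_last] for each fixed [y] and [z] controls the second. *)
Lemma sampling t (phi : V -> V -> V -> nat) (D : V -> V -> nat) :
  exists S : {ffun 'I_t -> V},
    t.+1 * (#|V| * (\sum_y \sum_z (D y z < \max_i phi y z (S i))) +
            \sum_y \sum_z \sum_x (\max_i phi y z (S i) < phi y z x))
    <= t.+1 * t * (\sum_y \sum_z \sum_x (D y z < phi y z x)) + #|V| ^ 3.
Proof.
apply: exists_le_average; first by rewrite card_ffun card_ord expn_gt0 V_gt0.
rewrite -big_distrr big_split -big_distrr /= !mulnDr card_ffun card_ord.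
apply: leq_add.
  rewrite -mulnA [leqRHS]mulnCA leq_pmul2l //.
  pose g x := \sum_y \sum_z (D y z < phi y z x) : nat.
  apply: (@leq_trans (\sum_(i < t) #|V| * \sum_(S : {ffun 'I_t -> V}) g (S i))).
    rewrite -big_distrr /= leq_mul2l; apply/orP; right.
    rewrite [leqRHS]exchange_big.
    apply: leq_sum => S _; rewrite /g [leqRHS]exchange_big.
    apply: leq_sum => y _; rewrite [leqRHS]exchange_big.
    by apply: leq_sum => z _; apply: ltn_bigmax_sum.
  rewrite (eq_bigr _ (fun i _ => sum_marginal1 i g)) sum_nat_const !card_ord.
  rewrite [leqRHS]mulnCA !leq_mul2l; apply/orP; right.
  rewrite /g exchange_big; apply/orP; right.
  by apply: leq_sum => y _; rewrite exchange_big.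
rewrite exchange_big big_distrr /= -expnD addn3.
apply: (@leq_trans (\sum_(y : V) #|V| * #|V| ^ t.+1)); last first.
  by rewrite sum_nat_const -!expnS.
apply: leq_sum => y _; rewrite exchange_big -sum_nat_const big_distrr /=.
by apply: leq_sum => z _; apply: strict_max_last.
Qed.

(** With [t = 2q] the hypothesis makes the right side of [sampling] at most [2 * #|V| ^ 3], which
    bounds both errors at once. *)
Lemma sampling_bound q (phi : V -> V -> V -> nat) (D : V -> V -> nat) :
  (q.*2.+1 * q.*2) * (\sum_y \sum_z \sum_x (D y z < phi y z x)) <= #|V| ^ 3 ->
  exists S : {ffun 'I_q.*2 -> V},
    q * (\sum_y \sum_z (D y z < \max_i phi y z (S i))) <= #|V| ^ 2 /\
    q * (\sum_y \sum_z \sum_x (\max_i phi y z (S i) < phi y z x)) <= #|V| ^ 3.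
Proof.
move=> few; have [S le_S] := sampling q.*2 phi D; exists S.
move: le_S few; set e := \sum_y \sum_z _; set u := \sum_y \sum_z \sum_x _.
set w := \sum_y \sum_z \sum_x _ => le_S few.
have le2 : q * (#|V| * e + u) <= #|V| ^ 3.
  have {few} := leq_trans le_S (leq_add few (leqnn _)).
  rewrite mulSn -doubleMl.
  by move: (#|V| * e + u) (#|V| ^ 3) => a b; lia.
split.
  rewrite -(leq_pmul2l V_gt0) -expnS mulnCA; apply: leq_trans le2.
  by rewrite leq_mul2l leq_addr orbT.
by apply: leq_trans le2; rewrite leq_mul2l leq_addl orbT.
Qed.

End Sampling.

(** * Containers, and the fingerprints that determine them *)

Section Containers.
Variables (V : finType) (r : nat).

(** No metric occurs here, so the bounds can be analysed once a fingerprint is fixed. The last two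
    conditions say that few triples are bad and that few of the intervals from [L] to [b] are
    empty. *)
Definition container q (b L : V -> V -> nat) :=
  [/\ forall x y, b x y <= r, forall x y, b x y = b y x,
      forall x y, L x y = L y x,
      q * (\sum_x \sum_y \sum_z (L x z + L y z < b x y)) <= #|V| ^ 3 &
      q * (\sum_x \sum_y (b x y < L x y)) <= 4 * #|V| ^ 2].

Definition escapes (b L D : V -> V -> nat) :=
  \sum_x \sum_y ~~ (L x y <= D x y <= b x y).

(* The distances from each point of the first and of the second sample to all
   points, then the second and the third sample themselves; the points of the
   first sample are never needed. *)
Definition fingerprint t1 t2 t3 :=
  ({ffun 'I_t1 * V -> 'I_r.+1} * {ffun 'I_t2 * V -> 'I_r.+1} *
   {ffun 'I_t2 -> V} * {ffun 'I_t3 -> V})%type.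

Variables t1 t2 t3 : nat.

(* The cap [r] on the distances and the minimum over the sample are both obtained
   from one maximum with the convention [\max = 0] on the empty range: this is
   [minn r (min_i (d x s_i + d s_i y))]. *)
Definition upper (F : fingerprint t1 t2 t3) x y :=
  r - \max_i (r - (F.1.1.1 (i, x) + F.1.1.1 (i, y))).

(** For a sample point [s], the relation [upper s y <= d s z + d y z], true for most triples,
    rearranges to a lower bound on [d y z]; the best one is kept. *)
Definition lower1 (F : fingerprint t1 t2 t3) y z :=
  \max_i (upper F (F.1.2 i) y - F.1.1.2 (i, z)).

(* [lower1] satisfies [upper x y <= d x z + lower1 y z] on most triples, which still
   mentions the metric; [lower2] replaces [d x z] by a quantity that depends on the
   fingerprint only. *)
Definition lower2 (F : fingerprint t1 t2 t3) x z :=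
  \max_i (upper F x (F.2 i) - lower1 F (F.2 i) z).

(** Both orders of the arguments enter to make the bound symmetric; the four terms account for the
    constant 4 in [container]. *)
Definition lower (F : fingerprint t1 t2 t3) x y :=
  maxn (maxn (lower1 F x y) (lower1 F y x)) (maxn (lower2 F x y) (lower2 F y x)).

End Containers.

(** The accuracy that [sampling_bound] requires in order to return accuracy [q]; three rounds of
    sampling use its iterates. *)
Definition step q := q.*2.+1 * q.*2.

Lemma leq_step q : q <= step q. Proof. rewrite /step; nia. Qed.

Lemma rotate_sum (V : finType) (F : V -> V -> V -> nat) :
  \sum_x \sum_y \sum_z F x y z = \sum_y \sum_z \sum_x F x y z.
Proof.
by rewrite exchange_big; apply: eq_bigr => y _; rewrite exchange_big.
Qed.

Lemma leq_nat_of_bool (a b : bool) : (a -> b) -> a <= b.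
Proof. by case: a => // ->. Qed.

Section Fingerprints.
Variables (V : finType) (r : nat) (D : V -> V -> nat).
Hypothesis V_gt0 : 0 < #|V|.
Hypothesis D_le : forall x y, D x y <= r.
Hypothesis D_sym : forall x y, D x y = D y x.
Hypothesis D_tri : forall x y z, D x y <= D x z + D z y.

Lemma exists_fingerprint q :
  exists F : fingerprint V r (step (step q)).*2 (step q).*2 q.*2,
    container r q (upper F) (lower F) /\
    q * escapes (upper F) (lower F) D <= 4 * #|V| ^ 2.
Proof.
(* First round: the minimum of [D x y + D x z] becomes a maximum after subtraction from [r], and the
   triangle inequality leaves no bad triple at the start. *)
have bad0 : step (step (step q)) * (\sum_y \sum_z \sum_x
    (r - D y z < r - (D x y + D x z))) <= #|V| ^ 3.
  rewrite big1 ?muln0 // => y _; rewrite big1 // => z _; rewrite big1 // => x _.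
  by apply/eqP; rewrite eqb0 -leqNgt leq_sub2l // (D_sym x y).
have [S1 [_ bad1]] := sampling_bound V_gt0 bad0.
set u : {ffun 'I_(step (step q)).*2 * V -> 'I_r.+1} :=
  [ffun p => inord (D (S1 p.1) p.2)].
pose b x y := r - \max_i (r - (u (i, x) + u (i, y))).
have uE i x : u (i, x) = D (S1 i) x :> nat.
  by rewrite ffunE inordK // ltnS.
have b_sym x y : b x y = b y x.
  by congr (r - _); apply: eq_bigr => i _; rewrite addnC.
have D_le_b x y : D x y <= b x y.
  suff: \max_i (r - (u (i, x) + u (i, y))) <= r - D x y.
    by have := D_le x y; rewrite /b; lia.
  apply/bigmax_leqP => i _; rewrite !uE.
  by rewrite leq_sub2l // (D_sym _ x).
(* The surviving triples, [D x z + D y z < b x y], are solved for [D y z], so that the second round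
   samples [x]. *)
have {}bad1 : step (step q) * (\sum_y \sum_z \sum_x
    (D y z < b x y - D x z)) <= #|V| ^ 3.
  apply: leq_trans bad1; rewrite leq_mul2l; apply/orP; right.
  rewrite [leqRHS]rotate_sum; apply: leq_sum => y _; apply: leq_sum => z _.
  apply: leq_sum => x _; apply: leq_nat_of_bool => lt_b.
  suff: \max_i (r - (D (S1 i) x + D (S1 i) y)) = \max_i (r - (u (i, x) + u (i, y))).
    by move=> ->; move: lt_b; rewrite /b !(D_sym z); lia.
  by apply: eq_bigr => i _; rewrite !uE.
have [S2 [e2 bad2]] := sampling_bound V_gt0 bad1.
set v : {ffun 'I_(step q).*2 * V -> 'I_r.+1} :=
  [ffun p => inord (D (S2 p.1) p.2)].
have vE i x : v (i, x) = D (S2 i) x :> nat by rewrite ffunE inordK // ltnS.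
pose a y z := \max_i (b (S2 i) y - v (i, z)).
have aE y z : \max_i (b (S2 i) y - D (S2 i) z) = a y z.
  by apply: eq_bigr => i _; rewrite vE.
(* The surviving triples are now solved for [D x z], and the third round samples [y]. What survives
   it, [c x z + a y z < b x y], no longer mentions [D]. *)
have {}bad2 : step q * (\sum_x \sum_z \sum_y (D x z < b x y - a y z)) <= #|V| ^ 3.
  apply: leq_trans bad2; rewrite leq_mul2l; apply/orP; right.
  rewrite [leqRHS]rotate_sum [leqRHS]exchange_big.
  apply: leq_sum => x _; apply: leq_sum => z _; apply: leq_sum => y _.
  apply: leq_nat_of_bool; rewrite aE; lia.
have [S3 [e3 bad3]] := sampling_bound V_gt0 bad2.
exists (u, v, S2, S3); set F := (u, v, S2, S3).
have lowE x y : lower F x y = maxn (maxn (a x y) (a y x))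
    (maxn (\max_i (b x (S3 i) - a (S3 i) y)) (\max_i (b y (S3 i) - a (S3 i) x))).
  by [].
have upE x y : upper F x y = b x y by [].
pose c x z := \max_i (b x (S3 i) - a (S3 i) z).
have {}lowE x y : lower F x y = maxn (maxn (a x y) (a y x)) (maxn (c x y) (c y x)).
  by [].
clearbody F; move: (upper F) (lower F) upE lowE => B L upE lowE.
have few : q * (\sum_x \sum_y (D x y < L x y)) <= 4 * #|V| ^ 2.
  have {}e2 : q * (\sum_x \sum_y (D x y < a x y)) <= #|V| ^ 2.
    apply: leq_trans e2; apply: leq_mul; first exact: leq_step.
    by apply: leq_sum => x _; apply: leq_sum => y _; rewrite aE.
  have {}e3 : q * (\sum_x \sum_y (D x y < c x y)) <= #|V| ^ 2 by [].
  apply: (@leq_trans (q * (\sum_x \sum_y (D x y < a x y) + \sum_x \sum_y (D y x < a y x)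
     + (\sum_x \sum_y (D x y < c x y) + \sum_x \sum_y (D y x < c y x))))); last first.
    have flip f : \sum_x \sum_y (D y x < f y x) = \sum_x \sum_y (D x y < f x y).
      exact: exchange_big.
    rewrite (flip a) (flip c) !mulnDr; lia.
  rewrite leq_mul2l; apply/orP; right; rewrite -!big_split /=; apply: leq_sum => x _.
  rewrite -!big_split /=; apply: leq_sum => y _.
  rewrite (D_sym y x) lowE !leq_max.
  case: (D x y < a x y) (D x y < a y x) => [] [];
    by case: (D x y < c x y) (D x y < c y x) => [] [].
split; last first.
  apply: leq_trans few; rewrite leq_mul2l; apply/orP; right.
  apply: leq_sum => x _; apply: leq_sum => y _; apply: leq_nat_of_bool.
  by rewrite upE D_le_b andbT ltnNge.
split.
- by move=> x y; rewrite upE leq_subr.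
- by move=> x y; rewrite !upE.
- by move=> x y; rewrite !lowE [maxn (a x y) _]maxnC [maxn (c x y) _]maxnC.
- apply: leq_trans bad3; rewrite leq_mul2l; apply/orP; right.
  apply: leq_sum => x _; rewrite exchange_big; apply: leq_sum => z _.
  apply: leq_sum => y _; apply: leq_nat_of_bool; rewrite upE !lowE -/(c x z); lia.
apply: leq_trans few; rewrite leq_mul2l; apply/orP; right.
apply: leq_sum => x _; apply: leq_sum => y _; apply: leq_nat_of_bool.
by rewrite upE; apply: leq_ltn_trans.
Qed.
End Fingerprints.

(** * The volume of a container, by averaging over cliques *)

Section CliqueSum.
Local Open Scope ring_scope.
Variables (I : finType) (w : I -> I -> int) (M : int).
Hypothesis M_ge0 : 0 <= M.
Hypothesis w_diag : forall x, w x x = 0.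
Hypothesis w_sym : forall x y, w x y = w y x.
Hypothesis w_le : forall x y, w x y <= M.
Hypothesis w_tri : forall x y z, x != y -> x != z -> y != z ->
  w x y + w x z + w y z <= 1.

(* If [w x y >= 1] then every other [z] satisfies [w x z + w y z <= 1 - w x y], so
   deleting [x] and [y] lowers the sum over ordered pairs by at most 2, unless
   nothing else is left. *)
Lemma clique_sum (A : {set I}) :
  \sum_(x in A) \sum_(y in A) w x y <= #|A|%:Z + 2 * M.
Proof.
have [n] := ubnP #|A|; elim: n A => // n IHn A /ltnSE le_An.
case: (pickP (fun p : I * I => [&& p.1 \in A, p.2 \in A & 1 <= w p.1 p.2]))
    => [[x y] /and3P[/= xA yA w_ge1]|no_edge]; last first.
  apply: (@le_trans _ _ 0); last by lia.
  rewrite sumr_le0 // => x xA; rewrite sumr_le0 // => y yA.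
  by have := no_edge (x, y); rewrite /= xA yA /=; lia.
have xy : x != y by apply: contraTneq w_ge1 => ->; rewrite w_diag.
pose B := A :\ x :\ y.
have yAx : y \in A :\ x by rewrite !inE eq_sym xy.
have cardA : #|A| = (#|B| + 2)%N.
  by rewrite (cardsD1 x) xA (cardsD1 y (A :\ x)) yAx -/B; lia.
have sumA (F : I -> int) : \sum_(z in A) F z = F x + F y + \sum_(z in B) F z.
  by rewrite (big_setD1 x) //= (big_setD1 y) //= addrA.
have -> : \sum_(u in A) \sum_(v in A) w u v = w x y *+ 2
    + (\sum_(z in B) (w x z + w y z)) *+ 2 + \sum_(u in B) \sum_(v in B) w u v.
  rewrite sumA (sumA (w x)) (sumA (w y)) (eq_bigr _ (fun u _ => sumA (w u))).
  have flip u : \sum_(v in B) w v u = \sum_(v in B) w u v.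
    by apply: eq_bigr => v _; rewrite w_sym.
  rewrite !big_split /= !flip.
  by rewrite !w_diag (w_sym y x) !mulr2n; ring.
have [B0|[z0 z0B]] := set_0Vmem B.
  rewrite B0 !big_set0 mul0rn !addr0 mulr2n; have := w_le x y; lia.
have IHB : \sum_(u in B) \sum_(v in B) w u v <= #|B|%:Z + 2 * M by apply: IHn; lia.
suff : \sum_(z in B) (w x z + w y z) <= 1 - w x y by move: IHB; lia.
have le_z z : z \in B -> w x z + w y z <= 1 - w x y.
  rewrite !inE => /and3P[zy zx _]; have := @w_tri x y z xy.
  by rewrite ![_ == z]eq_sym => /(_ zx zy); lia.
rewrite (bigD1 z0) //= -[leRHS]addr0 lerD ?le_z // sumr_le0 // => z /andP[zB _].
by have := le_z z zB; lia.
Qed.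

End CliqueSum.

Lemma sum_le_ord k (P : pred 'I_k) (F : 'I_k -> nat) c :
  (forall i, P i -> F i <= c) -> \sum_(i | P i) F i <= k * c.
Proof.
move=> le_c; apply: leq_trans (leq_sum _ le_c) _.
by rewrite sum_nat_const leq_mul2r -[leqRHS]card_ord max_card orbT.
Qed.

Section Volume.
Variables (V : finType) (r : nat) (b L : V -> V -> nat).
Hypothesis V_gt0 : 0 < #|V|.

Let s x y := (b x y).+1 - L x y.
Let m := r./2.+1.

Lemma clique_volume k (f : {ffun 'I_k -> V}) :
  (forall x y, b x y <= r) -> (forall x y, b x y = b y x) ->
  (forall x y, L x y = L y x) ->
  (forall i j : 'I_k, i != j -> L (f i) (f j) <= b (f i) (f j)) ->
  (forall i j l : 'I_k, i != j -> i != l -> j != l ->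
     b (f i) (f j) <= L (f i) (f l) + L (f j) (f l)) ->
  \sum_i \sum_(j | j != i) s (f i) (f j) <= k * k.-1 * m + k + 2 * m.
Proof.
move=> b_le b_sym L_sym L_le b_tri.
(* The diagonal is that of the indices, since [f] need not be injective. *)
pose w (i j : 'I_k) : int := (if i == j then 0 else (s (f i) (f j))%:Z - m%:Z)%R.
have s_sym i j : s i j = s j i by rewrite /s b_sym L_sym.
have s_le i j : s i j <= m + m.
  by have := b_le i j; rewrite /s /m; lia.
have := @clique_sum _ w m _ _ _ _ _ [set: 'I_k].
rewrite cardsT card_ord => clique.
have {clique}: (\sum_(x in [set: 'I_k]) \sum_(y in [set: 'I_k]) w x y
    <= k%:Z + 2 * m%:Z)%R.
  apply: clique => //.
  - by move=> i; rewrite /w eqxx.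
  - by move=> i j; rewrite /w eq_sym s_sym.
  - by move=> i j; rewrite /w; case: eqP => _ //; have := s_le (f i) (f j); lia.
  (* Adding the three triangle inequalities bounds the sum of the [b] by twice that of the [L]. The
     three lengths thus add up to at most [3 + 3 r / 2], which rounds down to [3 m], or to [3 m + 1]
     when [r] is odd. *)
  move=> i j l ij il jl; rewrite /w (negPf ij) (negPf il) (negPf jl) /s.
  have := L_le i j ij; have := L_le i l il; have := L_le j l jl.
  have := b_tri i j l ij il jl.
  have := b_tri i l j il ij; rewrite eq_sym => /(_ jl).
  have := b_tri j l i jl; rewrite eq_sym ij eq_sym il => /(_ isT isT).
  rewrite (L_sym (f l) (f j)) (L_sym (f l) (f i)) (L_sym (f j) (f i)).
  have := b_le (f i) (f j); have := b_le (f i) (f l); have := b_le (f j) (f l).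
  rewrite /m; lia.
have sumT (F : 'I_k -> int) : (\sum_(j in [set: 'I_k]) F j = \sum_j F j)%R.
  by apply: eq_bigl => j; rewrite inE.
have sumZ (P : pred 'I_k) (F : 'I_k -> nat) :
    Posz (\sum_(i | P i) F i) = (\sum_(i | P i) Posz (F i))%R.
  exact: (big_morph Posz PoszD).
have -> : (\sum_(x in [set: 'I_k]) \sum_(y in [set: 'I_k]) w x y)%R =
    ((\sum_i \sum_(j | j != i) s (f i) (f j))%:Z - (k * k.-1 * m)%:Z)%R.
  transitivity (\sum_(i < k) ((\sum_(j | j != i) s (f i) (f j))%:Z - (k.-1 * m)%:Z))%R.
    rewrite sumT; apply: eq_bigr => i _.
    rewrite sumT.
    rewrite (bigD1 i) //= {1}/w eqxx add0r sumZ.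
    rewrite (eq_bigr (fun j => (s (f i) (f j))%:Z - m%:Z)%R); last first.
      by move=> j ji; rewrite /w eq_sym (negPf ji).
    rewrite sumrB; congr (_ - _)%R.
    by rewrite sumr_const cardC1 card_ord; lia.
  rewrite sumrB sumr_const card_ord -sumZ.
  by congr (_ - _)%R; lia.
move: (\sum_i _) => S; lia.
Qed.

(** A uniform tuple of length [k = 4 h + 1] satisfies [clique_volume] unless it contains a bad pair
    or triple. Averaging bounds the mean of [s] by [m + (k + 3 m) / (k (k - 1))], hence by
    [m + m / h]. *)
Lemma container_volume h : 0 < h -> container r (10 * (4 * h).+1 ^ 5) b L ->
  h * (\sum_x \sum_y s x y) <= #|V| ^ 2 * (h.+1 * m).
Proof.
set k := (4 * h).+1; set q := 10 * k ^ 5; move=> h_gt0 [b_le b_sym L_sym few3 few2].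
set n := #|V|.
pose bad3 (f : {ffun 'I_k -> V}) :=
  \sum_i \sum_(j | j != i) \sum_(l | (l != i) && (l != j))
  (L (f i) (f l) + L (f j) (f l) < b (f i) (f j)).
pose bad2 (f : {ffun 'I_k -> V}) :=
  \sum_i \sum_(j | j != i) (b (f i) (f j) < L (f i) (f j)).
(* Each bad pair or triple is charged the trivial bound [s <= 2 m] on the whole clique. *)
have le_f (f : {ffun 'I_k -> V}) : \sum_i \sum_(j | j != i) s (f i) (f j) <=
    k * k.-1 * m + k + 2 * m + (bad3 f + bad2 f) * (k * k * (2 * m)).
  have [bad0|] := posnP (bad3 f + bad2 f).
    apply: leq_trans (leq_addr _ _); move/eqP: bad0.
    rewrite addn_eq0 => /andP[]; rewrite /bad3 /bad2 !sum_nat_eq0.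
    move=> /forallP bad3f /forallP bad2f; apply: clique_volume => //.
      move=> i j ij; have := bad2f i; rewrite sum_nat_eq0 => /forallP/(_ j).
      by rewrite eq_sym ij eqb0 -leqNgt.
    move=> i j l ij il jl; have := bad3f i; rewrite sum_nat_eq0 => /forallP/(_ j).
    rewrite eq_sym ij /= sum_nat_eq0 => /forallP/(_ l).
    by rewrite ![l == _]eq_sym il jl eqb0 -leqNgt.
  move=> bad_gt0; apply: leq_trans (leq_addl _ _).
  apply: leq_trans (leq_pmull _ bad_gt0).
  rewrite -mulnA; apply: sum_le_ord => i _; apply: sum_le_ord => j _.
  by have := b_le (f i) (f j); rewrite /s /m; lia.
have qE : q = 10 * k ^ 5 by [].
clearbody q.
have n3_gt0 : 0 < n ^ 3 by rewrite expn_gt0 V_gt0.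
have n2_gt0 : 0 < n ^ 2 by rewrite expn_gt0 V_gt0.
have sum_bad3 : q * (\sum_(f : {ffun 'I_k -> V}) bad3 f) <= k ^ 3 * n ^ k.
  rewrite (expnS k 2) (expnS k 1) expn1 -!mulnA.
  rewrite exchange_big big_distrr /=; apply: sum_le_ord => i _.
  rewrite exchange_big big_distrr /=; apply: sum_le_ord => j ji.
  rewrite exchange_big big_distrr /=; apply: sum_le_ord => l /andP[li lj].
  rewrite -(leq_pmul2l n3_gt0) mulnCA.
  rewrite (sum_marginal3 (fun x y z : V => L x z + L y z < b x y)) 1?eq_sym //.
  by rewrite card_ord mulnCA [leqRHS]mulnC leq_mul2l few3 orbT.
have sum_bad2 : q * (\sum_(f : {ffun 'I_k -> V}) bad2 f) <= k ^ 2 * (4 * n ^ k).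
  rewrite (expnS k 1) expn1 -!mulnA.
  rewrite exchange_big big_distrr /=; apply: sum_le_ord => i _.
  rewrite exchange_big big_distrr /=; apply: sum_le_ord => j ji.
  rewrite -(leq_pmul2l n2_gt0) mulnCA.
  rewrite (sum_marginal2 (fun x y : V => b x y < L x y)) 1?eq_sym //.
  by rewrite card_ord mulnCA [leqRHS]mulnC -[leqRHS]mulnA [leqRHS]mulnCA
    leq_mul2l few2 orbT.
have sum_s : n ^ 2 * (\sum_(f : {ffun 'I_k -> V}) \sum_i \sum_(j | j != i)
    s (f i) (f j)) =
    k * k.-1 * (n ^ k * \sum_x \sum_y s x y).
  rewrite exchange_big big_distrr /=.
  rewrite (eq_bigr (fun=> k.-1 * (n ^ k * \sum_x \sum_y s x y))).
    by rewrite sum_nat_const card_ord mulnA.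
  move=> i _; rewrite exchange_big big_distrr /=.
  rewrite (eq_bigr (fun=> n ^ k * \sum_x \sum_y s x y)).
    by rewrite sum_nat_const cardC1 card_ord.
  by move=> j ji; rewrite (sum_marginal2 s) 1?eq_sym // card_ord.
have := @leq_sum _ (index_enum {ffun 'I_k -> V}) xpredT _ _ (fun f _ => le_f f).
move: sum_bad3 sum_bad2 sum_s.
rewrite big_split /= sum_nat_const card_ffun card_ord -big_distrl big_split /= -/n.
move: (\sum_(f : {ffun 'I_k -> V}) bad3 f) => B3.
move: (\sum_(f : {ffun 'I_k -> V}) bad2 f) => B2.
set T := \sum_(f : {ffun 'I_k -> V}) _.
move: T (\sum_x \sum_y s x y) => T S le3 le2 eqS leT.
have {}eqS : n ^ 2 * T = k * (4 * h) * (n ^ k * S) := eqS.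
have q_gt0 : 0 < q by rewrite qE muln_gt0 expn_gt0.
have nk_gt0 : 0 < n ^ k by rewrite expn_gt0 V_gt0.
have le_bad : q * (B3 + B2) <= 5 * k ^ 3 * n ^ k.
  have : k ^ 2 * (4 * n ^ k) <= 4 * k ^ 3 * n ^ k.
    by rewrite mulnCA -mulnA leq_mul2l leq_mul2r leq_pexp2l ?orbT.
  move: le3 le2; rewrite mulnDr; lia.
(* On average there are at most [5 k^3 / q] violations, each costing [2 m k^2]; with [q = 10 k^5]
   they cost [m] in total, turning [2 m] into [3 m]. *)
have {}leT : T <= n ^ k * (k * (4 * h) * m + k + 3 * m).
  rewrite -(leq_pmul2l q_gt0); apply: leq_trans (leq_mul (leqnn q) leT) _.
  rewrite mulnDr [q * ((_ + _) * _)]mulnA.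
  apply: leq_trans (leq_add (leqnn _) (leq_mul le_bad (leqnn _))) _.
  apply: eq_leq; rewrite qE; move: (n ^ k) (k * (4 * h) * m + k) (k) => N c k'; ring.
have {}leT : k * (4 * h) * S <= n ^ 2 * (k * (4 * h) * m + k + 3 * m).
  by rewrite -(leq_pmul2l nk_gt0) mulnCA -eqS [leqRHS]mulnCA leq_pmul2l.
have k4_gt0 : 0 < 4 * k by rewrite muln_gt0.
rewrite -(leq_pmul2l k4_gt0).
have -> : 4 * k * (h * S) = k * (4 * h) * S by ring.
apply: leq_trans leT _; rewrite -/n [leqRHS]mulnCA leq_pmul2l //.
by rewrite /k /m; nia.
Qed.
End Volume.

(** * Counting functions on pairs that mostly stay in given intervals *)

Lemma AGM_nat (I : finType) (a : I -> nat) :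
  #|I| ^ #|I| * \prod_i a i <= (\sum_i a i) ^ #|I|.
Proof.
have [] := @leif_AGM_scaled int I predT (fun i => (a i)%:R)%R.
  by move=> i _; rewrite mulrn_wge0.
move=> le_prod _; rewrite -prod_nat_const -big_split /= -(ler_nat int).
rewrite natrX natr_prod natr_sum; apply: le_trans le_prod.
by rewrite le_eqVlt; apply/orP; left; apply/eqP; apply: eq_bigr => i _;
  rewrite natrM mulr_natl.
Qed.

Lemma sum_interval N L b : \sum_(v < N) (L <= v <= b) <= minn N b.+1 - L.
Proof.
elim: N => [|N IHN]; first by rewrite big_ord0.
by rewrite big_ord_recr /=; move: IHN; case: andP => [[]|] /=; lia.
Qed.

Section Dist.
Variables n r : nat.
Implicit Types (d : {ffun point_pair n -> 'I_r.+1}) (e : point_pair n).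

Lemma dist_le d x y : dist d x y <= r.
Proof. by rewrite /dist; case: insubP => // e _ _; rewrite -ltnS. Qed.

Lemma dist_sym d x y : dist d x y = dist d y x.
Proof. by rewrite /dist finset.setUC. Qed.

Lemma dist_diag d x : dist d x x = 0.
Proof. by rewrite /dist insubF // finset.setUid cards1. Qed.

Lemma dist_triangle d x y z : is_metric d -> dist d x y <= dist d x z + dist d z y.
Proof.
move=> /andP[_ /forallP/(_ x)/forallP/(_ y)/forallP/(_ z)/implyP tri].
have [->|xy] := eqVneq x y; first by rewrite dist_diag.
have [->|xz] := eqVneq x z; first by rewrite dist_diag.
have [->|zy] := eqVneq z y; first by rewrite dist_diag addn0.
by apply: tri; rewrite xy xz zy.
Qed.

Lemma exists_ends e : exists p : 'I_n * 'I_n, (p.1 < p.2) && (val e == [set p.1; p.2]).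
Proof.
have /cards2P[x [y [xy eE]]] := valP e.
have [lt_xy|lt_yx|/ord_inj xyE] := ltngtP x y.
- by exists (x, y); rewrite lt_xy eE eqxx.
- by exists (y, x); rewrite lt_yx eE finset.setUC eqxx.
by rewrite xyE eqxx in xy.
Qed.

Definition ends e := xchoose (exists_ends e).

Lemma ends_lt e : (ends e).1 < (ends e).2.
Proof. by have /andP[] := xchooseP (exists_ends e). Qed.

Lemma endsE e : val e = [set (ends e).1; (ends e).2].
Proof. by have /andP[_ /eqP] := xchooseP (exists_ends e). Qed.

Lemma ends_inj : injective ends.
Proof. by move=> e1 e2 eq_ends; apply: val_inj; rewrite !endsE eq_ends. Qed.

Lemma dist_ends d e : dist d (ends e).1 (ends e).2 = d e.
Proof. by rewrite /dist -endsE valK. Qed.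

Lemma sum_ends (s : 'I_n -> 'I_n -> nat) :
  \sum_e s (ends e).1 (ends e).2 <= \sum_(x < n) \sum_(y < n | x < y) s x y.
Proof.
rewrite pair_big_dep /= -(big_imset (fun p => s p.1 p.2) (in2W ends_inj)) /=.
rewrite big_mkcond [leqRHS]big_mkcond; apply: leq_sum => p _.
by case: imsetP => // -[e _ ->]; rewrite ends_lt.
Qed.

Lemma sum_ends2 (s : 'I_n -> 'I_n -> nat) : (forall x y, s x y = s y x) ->
  2 * (\sum_e s (ends e).1 (ends e).2) <= \sum_x \sum_y s x y.
Proof.
move=> s_sym; rewrite mul2n -addnn.
apply: leq_trans (leq_add (sum_ends s) (sum_ends s)) _.
rewrite [X in _ + X](exchange_big_dep xpredT) //= -big_split /=; apply: leq_sum => x _.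
rewrite [leqRHS](bigID (fun y : 'I_n => x < y)) /= leq_add2l.
rewrite [leqRHS]big_mkcond [leqLHS]big_mkcond; apply: leq_sum => y _.
by rewrite s_sym; case: ltngtP.
Qed.

Lemma card_point_pair : #|{: point_pair n}| = 'C(n, 2).
Proof. by rewrite card_sig -[in RHS](card_ord n) -card_draws cardsE. Qed.

(* Expanding the product of sums, a function with at most [c] values outside the
   boxes receives weight at least [K ^ ('C(n, 2) - c)]. *)
Lemma card_close (b L : 'I_n -> 'I_n -> nat) K c : 0 < K ->
  #|[pred d : {ffun point_pair n -> 'I_r.+1} | escapes b L (dist d) <= c]|
    * K ^ 'C(n, 2) <=
  K ^ c * \prod_e (K * ((b (ends e).1 (ends e).2).+1 - L (ends e).1 (ends e).2) + r.+1).
Proof.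
move=> K_gt0; pose B e (v : 'I_r.+1) :=
  L (ends e).1 (ends e).2 <= v <= b (ends e).1 (ends e).2.
apply: (@leq_trans (K ^ c * \prod_e \sum_v (if B e v then K else 1))); last first.
  rewrite leq_mul2l; apply/orP; right; apply: leq_prod => e _.
  apply: (@leq_trans (\sum_v (K * B e v + 1))).
    by apply: leq_sum => v _; case: (B e v); lia.
  rewrite big_split /= sum_nat_const card_ord muln1 leq_add2r -big_distrr /=.
  rewrite leq_mul2l; apply/orP; right; apply: leq_trans (sum_interval _ _ _) _.
  by rewrite leq_sub2r // geq_minr.
rewrite bigA_distr_bigA big_distrr /= -sum_nat_const big_mkcond.
apply: leq_sum => d _; rewrite inE; case: ifP => // le_c.
have -> : \prod_e (if B e (d e) then K else 1) = K ^ #|[pred e | B e (d e)]|.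
  by rewrite -prod_nat_const [RHS]big_mkcond.
rewrite -expnD leq_pexp2l //.
rewrite -card_point_pair -(cardC [pred e | B e (d e)]) addnC leq_add2r.
apply: leq_trans le_c; rewrite -sum1_card big_mkcond.
pose out x y : nat := ~~ (L x y <= dist d x y <= b x y).
apply: (@leq_trans (\sum_e out (ends e).1 (ends e).2)).
  by apply: leq_sum => e _; rewrite !inE /out dist_ends -/(B e (d e)); case: (B e _).
apply: leq_trans (sum_ends out) _.
by apply: leq_sum => x _; rewrite big_mkcond; apply: leq_sum => y _; case: ifP.
Qed.

End Dist.

Lemma num_metrics_ge n r : 0 < r -> r./2.+1 ^ 'C(n, 2) <= num_metrics n r.
Proof.
move=> r_gt0; pose m := r./2.+1.
(* The values are [r - m + 1, ..., r]. Twice the smallest is at least [r], so triangle inequalities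
   are automatic; [0 < r] gives [m <= r], which keeps the values in range. *)
pose shift (v : 'I_m) : 'I_r.+1 := inord (r - m + v.+1).
have shiftE (v : 'I_m) : shift v = r - m + v.+1 :> nat.
  by rewrite /shift inordK //; have := ltn_ord v; rewrite /m; lia.
pose G (d : {ffun point_pair n -> 'I_m}) : {ffun point_pair n -> 'I_r.+1} :=
  [ffun e => shift (d e)].
have G_inj : injective G.
  move=> d1 d2 /ffunP eqG; apply/ffunP => e; apply/val_inj.
  by have := eqG e; rewrite !ffunE => /(congr1 val) /=; rewrite !shiftE; lia.
rewrite -[m in m ^ _]card_ord -card_point_pair -card_ffun -(card_imset _ G_inj).
apply/subset_leq_card/fintype.subsetP => _ /imsetP[d _ ->]; rewrite inE.
have dist_bounds x y : x != y -> r - m < dist (G d) x y <= r.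
  move=> xy; rewrite dist_le andbT /dist insubT ?cards2 ?xy // => xy2.
  by rewrite ffunE shiftE; lia.
apply/andP; split.
  by apply/forallP => e; rewrite ffunE shiftE; lia.
apply/forallP => x; apply/forallP => y; apply/forallP => z; apply/implyP.
move=> /and3P[/dist_bounds ? /dist_bounds ? /dist_bounds ?].
rewrite /m in dist_bounds *.
lia.
Qed.

(** For [r = 1] the base of the power is 1 and no exponent can absorb an error, so the count must be
    exact. *)
Lemma num_metrics1_le n : num_metrics n 1 <= 1.
Proof.
apply/card_le1_eqP => d1 d2; rewrite !inE.
move=> /andP[/forallP d1_gt0 _] /andP[/forallP d2_gt0 _].
apply/ffunP => e; apply/val_inj; move: (d1_gt0 e) (d2_gt0 e) => /=.
by case: (d1 e) (d2 e) => [[|[|?]] ?] [[|[|?]] ?].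
Qed.

(** * The upper bound for the number of metrics *)

Lemma close_le n r h (b L : 'I_n -> 'I_n -> nat) c : 0 < h < n ->
  container r (10 * (4 * h).+1 ^ 5) b L ->
  #|[pred d : {ffun point_pair n -> 'I_r.+1} | escapes b L (dist d) <= c]|
    * h ^ 'C(n, 2) <= h.*2 ^ c * (r./2.+1 * (h + 4)) ^ 'C(n, 2).
Proof.
move=> /andP[h_gt0 lt_hn] bL; set m := r./2.+1; set M := 'C(n, 2).
have n_gt0 : 0 < #|'I_n| by rewrite card_ord; lia.
have M_gt0 : 0 < M by rewrite bin_gt0; lia.
have eqM : 2 * M = n * n.-1.
  by rewrite /M bin2 mul2n even_halfK // oddM; case: (n) => //= k; rewrite andNb.
have := container_volume n_gt0 h_gt0 bL; rewrite card_ord -/m.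
have [_ b_sym L_sym _ _] := bL.
pose s x y := (b x y).+1 - L x y.
have s_sym x y : s x y = s y x by rewrite /s b_sym L_sym.
have := sum_ends2 s_sym.
rewrite -[\sum_x \sum_y ((b x y).+1 - L x y)]/(\sum_x \sum_y s x y).
move: (\sum_x \sum_y s x y) => S2 le_S vol.
have h2_gt0 : 0 < h.*2 by lia.
have := @card_close n r b L h.*2 c h2_gt0.
pose a (e : point_pair n) := h.*2 * s (ends e).1 (ends e).2 + r.+1.
rewrite -[\prod_e _]/(\prod_e a e) -/M => close.
(* The 4 absorbs three losses: the excess in [container_volume], the passage from [n^2] to
   [n (n - 1)], which uses [h < n], and the outside weight [r + 1 <= 2 m]. Together they amount to
   [(h + 1)^2 + h <= h (h + 4)]. *)
have sum_a : \sum_e a e <= M * (2 * (m * (h + 4))).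
  rewrite big_split /= sum_nat_const card_point_pair -/M -big_distrr /=.
  move: (\sum_e s _ _) le_S => S le_S.
  rewrite -(leq_pmul2l h_gt0).
  have le1 : h * (h.*2 * S) <= n ^ 2 * (h.+1 * m) * h.
    rewrite mulnC leq_mul2r; apply/orP; right; apply: leq_trans vol.
    by rewrite -mul2n -mulnA mulnCA leq_mul2l le_S orbT.
  have le2 : n ^ 2 * (h.+1 * m) * h <= 2 * M * (h.+1 ^ 2 * m).
    have le_nh : n * h <= n.-1 * h.+1 by nia.
    have -> : n ^ 2 * (h.+1 * m) * h = n * h.+1 * m * (n * h) by ring.
    apply: leq_trans (leq_mul (leqnn _) le_nh) _.
    by rewrite eqM; apply: eq_leq; ring.
  have le3 : h * (M * r.+1) <= 2 * M * (h * m).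
    rewrite [h * (M * _)]mulnCA [2 * M]mulnC -mulnA leq_mul2l; apply/orP; right.
    rewrite [2 * _]mulnCA leq_mul2l; apply/orP; right; rewrite /m; lia.
  rewrite mulnDr; apply: leq_trans (leq_add (leq_trans le1 le2) le3) _.
  have -> : h * (M * (2 * (m * (h + 4)))) = 2 * M * m * (h * (h + 4)) by ring.
  have -> : 2 * M * (h.+1 ^ 2 * m) + 2 * M * (h * m) =
      2 * M * m * (h.+1 ^ 2 + h) by ring.
  by rewrite leq_mul2l; apply/orP; right; nia.
have prod_a : \prod_e a e <= (2 * (m * (h + 4))) ^ M.
  have MM_gt0 : 0 < M ^ M by rewrite expn_gt0 M_gt0.
  rewrite -(leq_pmul2l MM_gt0) -expnMn.
  have := AGM_nat a; rewrite card_point_pair -/M => /leq_trans; apply.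
  by rewrite leq_exp2r.
have two_gt0 : 0 < 2 ^ M by rewrite expn_gt0.
rewrite -(leq_pmul2l two_gt0) mulnCA -expnMn mul2n [leqRHS]mulnCA -expnMn.
by apply: leq_trans close _; rewrite leq_mul2l prod_a orbT.
Qed.

(** The bound of [close_le] is summed over all fingerprints. The total sample size [T] depends on
    [h] alone, so for fixed [h] the logarithm of their number is linear in [n] up to the factor
    [ln (r + 1)] and a term [T ln n]. *)
Lemma num_metrics_le h : exists T : nat, forall n r, 0 < h < n ->
  num_metrics n r * h ^ 'C(n, 2) <=
  n ^ T * r.+1 ^ (T * n) *
  (h.*2 ^ ((4 * n ^ 2) %/ (10 * (4 * h).+1 ^ 5)) * (r./2.+1 * (h + 4)) ^ 'C(n, 2)).
Proof.
set q := 10 * (4 * h).+1 ^ 5; pose t1 := (step (step q)).*2; pose t2 := (step q).*2.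
exists (t1 + t2 + q.*2) => n r h_n; set c := _ %/ q; set X := h.*2 ^ c * _.
have n_gt0 : 0 < #|'I_n| by rewrite card_ord; lia.
have q_gt0 : 0 < q by rewrite muln_gt0 expn_gt0.
pose good (F : fingerprint 'I_n r t1 t2 q.*2) (d : {ffun point_pair n -> 'I_r.+1}) :=
  `[< container r q (upper F) (lower F) >] &&
  (escapes (upper F) (lower F) (dist d) <= c).
have cover : num_metrics n r <= \sum_F #|[pred d | good F d]|.
  rewrite /num_metrics -sum1_card.
  under [leqRHS]eq_bigr => F _ do rewrite -sum1_card big_mkcond.
  rewrite exchange_big big_mkcond; apply: leq_sum => d _ /=; rewrite !inE.
  case: ifP => // d_metric.
  have [F [F_good le_esc]] := exists_fingerprint n_gt0 (@dist_le n r d)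
    (@dist_sym n r d) (fun x y z => @dist_triangle n r d x y z d_metric) q.
  rewrite (bigD1 F) //= inE /good (asboolT F_good) leq_divRL // mulnC.
  by rewrite card_ord in le_esc; rewrite le_esc.
have card_F : #|{: fingerprint 'I_n r t1 t2 q.*2}| <=
    n ^ (t1 + t2 + q.*2) * r.+1 ^ ((t1 + t2 + q.*2) * n).
  rewrite !card_prod !card_ffun !card_prod !card_ord -mulnA -!expnD -mulnDl mulnC.
  apply: leq_mul; first by rewrite leq_pexp2l // ?leq_add2r ?leq_addl //; lia.
  by rewrite leq_pexp2l // leq_mul2r leq_addr orbT.
apply: leq_trans (leq_mul card_F (leqnn _)).
apply: leq_trans (leq_mul cover (leqnn _)) _.
rewrite -sum_nat_const big_distrl; apply: leq_sum => F _ /=.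
rewrite /good; case: asboolP => [F_good|_]; last by rewrite (eq_card0 (A := _)).
exact: close_le.
Qed.

(** * Logarithms and the asymptotic statement *)

Local Open Scope classical_set_scope.
Local Open Scope ring_scope.

Lemma ceil_half_succ (R : realType) r : Num.ceil (r.+1%:R / 2 : R) = (r./2.+1)%:Z.
Proof.
apply/ceil_def/andP.
have : r.+1%:R = (odd r)%:R + (r./2)%:R * 2 + 1 :> R.
  by rewrite -natrM -natrD -natr1 muln2 odd_double_half.
rewrite intrD -!pmulrn -natr1 => ->; case: (odd r) => /=; split; lra.
Qed.

Section LnNat.
Variable R : realType.

Lemma ln_natM a b : (0 < a)%N -> (0 < b)%N ->
  ln ((a * b)%:R : R) = ln a%:R + ln b%:R.
Proof. by move=> a_gt0 b_gt0; rewrite natrM lnM // posrE ltr0n. Qed.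

Lemma ln_natX a k : (0 < a)%N -> ln ((a ^ k)%:R : R) = k%:R * ln a%:R.
Proof. by move=> a_gt0; rewrite natrX lnXn ?ltr0n // mulr_natl. Qed.

Lemma ln_nat_le a b : (0 < a)%N -> (a <= b)%N -> ln (a%:R : R) <= ln b%:R.
Proof.
by move=> a_gt0 le_ab; rewrite ler_ln ?posrE ?ltr0n ?ler_nat // (leq_trans a_gt0).
Qed.

Lemma ln_nat_leid a : ln (a%:R : R) <= a%:R.
Proof.
case: a => [|a]; first by rewrite ln0.
have := @le_ln1Dx R a%:R; rewrite [1 + _]addrC natr1 => le_a.
by apply: le_trans (le_a _) _; rewrite ?ler_nat // (lt_le_trans _ (ler0n _ _)) ?ltrN10.
Qed.

End LnNat.

(** Of the term [5 n^2 / h], one part comes from the exceptional pairs and four from the factor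
    [1 + 4 / h] per pair. *)
Lemma ln_num_metrics_le (R : realType) (h : nat) : (0 < h)%N ->
  exists T : nat, forall n r, (h < n)%N -> (0 < r)%N ->
  ln ((num_metrics n r)%:R : R) <= T%:R * n%:R + (T * n)%:R * ln (r.+1%:R) +
    5 * n%:R ^+ 2 / h%:R + 'C(n, 2)%:R * ln (r./2.+1%:R).
Proof.
move=> h_gt0; have [T le_T] := num_metrics_le h; exists T => n r lt_hn r_gt0.
have := le_T n r; rewrite h_gt0 lt_hn => /(_ isT).
set c := (_ %/ _)%N; set M := 'C(n, 2).
have N_gt0 : (0 < num_metrics n r)%N.
  by apply: leq_trans (num_metrics_ge n r_gt0); rewrite expn_gt0.
have n_gt0 : (0 < n)%N by lia.
have h4_gt0 : (0 < h + 4)%N by lia.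
have h2_gt0 : (0 < h.*2)%N by lia.
have m_gt0 : (0 < r./2.+1 * (h + 4))%N by rewrite muln_gt0.
move=> /(ln_nat_le R (_ : (0 < _)%N)).
rewrite muln_gt0 N_gt0 expn_gt0 h_gt0 => /(_ isT).
rewrite !(ln_natM, ln_natX) ?muln_gt0 ?expn_gt0 ?m_gt0 ?n_gt0 ?h2_gt0 ?h4_gt0 ?h_gt0 //.
set m := r./2.+1 => le_ln.
have h_gt0R : (0 : R) < h%:R by rewrite ltr0n.
have le_n : T%:R * ln (n%:R : R) <= T%:R * n%:R by rewrite ler_wpM2l ?ln_nat_leid.
have le_h : ln ((h + 4)%:R : R) - ln h%:R <= 4 / h%:R.
  rewrite -ln_div ?posrE ?ltr0n // natrD mulrDl divff ?gt_eqF //.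
  by apply: le_ln1Dx; apply: lt_le_trans (_ : 0 <= _); rewrite ?ltrN10 ?divr_ge0.
have le_M : (M%:R : R) <= n%:R ^+ 2.
  rewrite -natrX ler_nat /M bin2.
  have : (n * n.-1 <= n * n)%N by rewrite leq_mul2l leq_pred orbT.
  by rewrite expnS expn1; lia.
(* The crude [ln (2 h) <= 2 h] suffices, as [c] is at most [4 n^2 / q] with [q] of order [h^5]. *)
have le_c : c%:R * ln (h.*2%:R : R) <= n%:R ^+ 2 / h%:R.
  apply: le_trans (ler_wpM2l _ (ln_nat_leid R _)) _; first exact: ler0n.
  rewrite ler_pdivlMr // -natrX -!natrM ler_nat.
  have le_q : (8 * h ^ 2 <= 10 * (4 * h).+1 ^ 5)%N.
    have : ((4 * h).+1 ^ 2 <= (4 * h).+1 ^ 5)%N by rewrite leq_pexp2l.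
    by rewrite !(expnS _ 1) !expn1; nia.
  have := leq_trans (leq_mul (leqnn c) le_q) (leq_divM _ _).
  have -> : (c * (8 * h ^ 2) = 4 * (c * h.*2 * h))%N by rewrite -mul2n; ring.
  by rewrite leq_pmul2l.
have le_Mh : M%:R * (ln ((h + 4)%:R : R) - ln h%:R) <= n%:R ^+ 2 * (4 / h%:R).
  apply: le_trans (ler_wpM2l (ler0n _ _) le_h) _.
  by rewrite ler_wpM2r // divr_ge0.
by move: le_ln le_Mh le_c le_n; lra.
Qed.

Theorem theorem3p1 (R : realType) (eps : R) (eps_gt0 : 0 < eps)
    (r : nat -> nat) (r_gt0 : forall n : nat, (0 < r n)%N)
    (r_bigO : (fun n : nat => (r n)%:R : R) =O_\oo
       (fun n : nat => (n%:R : R) `^ (1 / 3) / (ln n%:R) `^ (4 / 3 + eps))) :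
  exists2 g : nat -> R,
    g =o_\oo (fun n : nat => (n%:R : R) ^+ 2) &
    forall n : nat,
      (num_metrics n (r n))%:R =
        (Num.ceil ((r n).+1%:R / 2 : R))%:~R `^ ('C(n, 2)%:R + g n).
Proof.
pose m n : nat := (r n)./2.+1.
pose N n := num_metrics n (r n).
have N_gt0 n : (0 < N n)%N.
  by apply: leq_trans (num_metrics_ge n (r_gt0 n)); rewrite expn_gt0.
(* The equation solved for the exponent. If [m n = 1], division by [ln 1 = 0] yields 0, which is
   correct because then [N n = 1]. *)
exists (fun n => (ln (N n)%:R - 'C(n, 2)%:R * ln (m n)%:R) / ln (m n)%:R); last first.
  move=> n; rewrite ceil_half_succ -pmulrn -/(m n) -/(N n).
  have [m1|m_gt1] := leqP (m n) 1.
    have m_eq1 : m n = 1%N by apply/eqP; rewrite eqn_leq m1.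
    have r1 : r n = 1%N by move: (r_gt0 n) m1; rewrite /m; lia.
    have -> : N n = 1%N by apply/eqP; rewrite eqn_leq N_gt0 andbT /N r1 num_metrics1_le.
    by rewrite m_eq1 powR1.
  have ln_m_gt0 : 0 < ln ((m n)%:R : R) by rewrite ln_gt0 // ltr1n.
  rewrite mulrBl mulfK ?gt_eqF // addrC subrK /powR gt_eqF ?ltr0n //=.
  by rewrite divfK ?gt_eqF // lnK // posrE ltr0n.
have ln2_gt0 : 0 < ln (2 : R) by rewrite ln_gt0 // ltr1n.
apply/eqoP => e e_gt0.
have e2_gt0 : 0 < e * ln 2 by rewrite mulr_gt0.
(* Since [l >= ln 2], this makes [5 n^2 / h] at most half of the allowed error [e n^2 l]. *)
pose h := Num.bound (10 / (e * ln 2)).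
have h_gt : 10 / (e * ln 2) < h%:R.
  by apply: archi_boundP; rewrite divr_ge0 // ltW.
have h_gt0 : (0 < h)%N.
  by rewrite -(ltr0n R); apply: le_lt_trans h_gt; rewrite divr_ge0 // ltW.
have [T le_ln] := @ln_num_metrics_le R h h_gt0.
(* For [n > B] the fingerprint term, at most [(T / ln 2 + 2 T) n l], fits into the other half. *)
pose B := (T%:R / ln 2 + 2 * T%:R) * 2 / e : R.
have B_ge0 : 0 <= B.
  have Tl_ge0 : (0 : R) <= T%:R / ln 2 by rewrite divr_ge0 // ltW.
  by rewrite divr_ge0 ?(ltW e_gt0) // mulr_ge0 // addr_ge0 // mulr_ge0.
exists (maxn h.+1 (Num.bound B)) => // n /=; rewrite geq_max => /andP[lt_hn le_Bn].
have {le_Bn} lt_B : B < n%:R.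
  by apply: lt_le_trans (archi_boundP B_ge0) _; rewrite ler_nat.
set M := 'C(n, 2); set l := ln (m n)%:R.
have n2_ge0 : (0 : R) <= n%:R ^+ 2 by rewrite sqr_ge0.
rewrite (ger0_norm n2_ge0).
have [m1|m_gt1] := leqP (m n) 1.
  have m_eq1 : m n = 1%N by apply/eqP; rewrite eqn_leq m1.
  by rewrite /l m_eq1 ln1 invr0 mulr0 normr0 mulr_ge0 // ltW.
have le_2l : ln (2 : R) <= l by apply: ln_nat_le.
have l_gt0 : 0 < l by apply: lt_le_trans le_2l.
have ge_M : M%:R * l <= ln ((N n)%:R : R).
  rewrite /l -ln_natX //; apply: ln_nat_le; first by rewrite expn_gt0.
  exact: num_metrics_ge.
rewrite ger0_norm; last by rewrite divr_ge0 ?subr_ge0 // ltW.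
rewrite ler_pdivrMr //.
(* For [m >= 2] one has [r + 1 <= 2 m <= m^2]. *)
have le_r : ln ((r n).+1%:R : R) <= 2 * l.
  have -> : 2 * l = ln (m n ^ 2)%:R by rewrite ln_natX.
  apply: ln_nat_le => //; move: m_gt1; rewrite /m expnS expn1; nia.
have := le_ln n (r n) lt_hn (r_gt0 n); rewrite -/(N n) -/M -/(m n) -/l => le_N.
have nl_ge0 : 0 <= n%:R * l by rewrite mulr_ge0 // ltW.
have le1 : 5 * n%:R ^+ 2 / h%:R <= e / 2 * n%:R ^+ 2 * l.
  rewrite ler_pdivrMr ?ltr0n //.
  have le_el : 10 <= h%:R * (e * l).
    move: h_gt; rewrite ltr_pdivrMr // => /ltW/le_trans; apply.
    by rewrite !ler_wpM2l // ltW.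
  by have := ler_wpM2l n2_ge0 le_el; lra.
have le2 : T%:R * n%:R + (T * n)%:R * ln (r n).+1%:R <= e / 2 * n%:R ^+ 2 * l.
  apply: (@le_trans _ _ ((T%:R / ln 2 + 2 * T%:R) * (n%:R * l))).
    have Tn_ge0 : (0 : R) <= T%:R * n%:R by rewrite mulr_ge0.
    have le_l : 1 <= l / ln 2 by rewrite ler_pdivlMr // mul1r.
    have := ler_wpM2l Tn_ge0 le_l; have := ler_wpM2l Tn_ge0 le_r.
    by rewrite natrM; lra.
  move: lt_B; rewrite /B ltr_pdivrMr // => /ltW le_B.
  by have := ler_wpM2r nl_ge0 le_B; lra.
lra.
Qed.
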